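(* Let $LIP(\mathbb Z)$ denote the set of LIP functions $\mathbb Z\to\mathbb Z$. Then: (1) if $f,g\in LIP(\mathbb Z)$ then the composition $x\mapsto f(g(x))$ is in $LIP(\mathbb Z)$; (2) if $f\in LIP(\mathbb Z)$ then the function $x\mapsto f(x)-f(x-1)$ is in $LIP(\mathbb Z)$.
   Context: A function $f\colon\mathbb Z\to\mathbb Z$ is LIP on $\mathbb Z$ if for every finite $X\subseteq\mathbb Z$ there is $p\in\mathbb Z[x]$ with $p(x)=f(x)$ for all $x\in X$. *)

(* Defs.v *)
From mathcomp Require Import all_boot all_order all_algebra.

Set Implicit Arguments.
Unset Strict Implicit.
Unset Printing Implicit Defensive.

Import GRing.Theory.
Local Open Scope ring_scope.

(* Finite subsets of Z are given by lists; the order and the repetitions of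
   the elements of X are irrelevant, as only membership in X is used. *)
Definition LIP (f : int -> int) : Prop :=
  forall X : seq int, exists p : {poly int}, forall x, x \in X -> p.[x] = f x.

(* Main.v *)
Require Import Defs.
From mathcomp Require Import all_boot all_order all_algebra.

Set Implicit Arguments.
Unset Strict Implicit.
Unset Printing Implicit Defensive.

Import GRing.Theory.
Local Open Scope ring_scope.

(** Integer polynomials are closed under composition and subtraction, so interpolants can be
    combined like the functions they match, provided each is taken on a large enough finite set: for
    [f (g x)], [f] is interpolated on the image of [X] under [g]. *)

Theorem theorem5 :
  (forall f g : int -> int, LIP f -> LIP g -> LIP (fun x : int => f (g x))) /\
  (forall f : int -> int, LIP f -> LIP (fun x : int => f x - f (x - 1))).
Proof.
split=> [f g Lf Lg X | f Lf X].
  have [q qE] := Lg X; have [p pE] := Lf (map g X).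
  by exists (p \Po q) => x Xx; rewrite horner_comp qE // pE // map_f.
(* Adding the shift of [X] by 1 lets a single [p] match [f] at both [x] and [x - 1]. *)
have [p pE] := Lf (X ++ [seq x - 1 | x <- X]).
exists (p - (p \Po ('X - 1%:P))) => x Xx.
rewrite hornerD hornerN horner_comp hornerXsubC.
by rewrite !pE // mem_cat ?Xx // (map_f (fun y => y - 1)) // orbT.
Qed.
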